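(* Let $S=K[x_1,\ldots,x_n]$ be a polynomial ring over a field $K$, let $d\geq 2$, and let $u,v\in S$ be monomials of degree $d$ with $u>_{lex}v$, $x_1\mid u$ and $x_1\nmid v$. Assume that the lexsegment ideal $I=(\mathcal{L}(u,v))\subset S$ has a linear resolution and is not a completely lexsegment ideal. Let $k\geq1$ and let $g:M(I^k)\rightarrow G(I^k)$ be the decomposition function with respect to the increasing reverse lexicographical order. Then, for any $m\in G(I^k)$, written $m=\overline{m}\,\tilde{m}$, and any $s\in\mathrm{set}(m)$, $$g(x_sm)=\begin{cases} x_sm/x_{\min(m)}, & \text{if } x_sm/x_{\min(m)}\succeq v^k,\\ x_sm/x_{\min(\tilde{m})}, & \text{if } x_sm/x_{\min(m)}\prec v^k.\end{cases}$$
   Context: $<_{lex}$ is the lexicographical order with $x_1>_{lex}\cdots>_{lex}x_n$. For monomials $u\geq_{lex}v$ of degree $d$, $\mathcal{L}(u,v)$ is the set of all monomials $w$ of degree $d$ with $u\geq_{lex}w\geq_{lex}v$; such a set is called a lexsegment set, and $(\mathcal{L}(u,v))$, the ideal it generates, a lexsegment ideal. For a set $T$ of monomials, $\mathrm{Shad}(T)=\{x_iw : 1\leq i\leq n,\ w\in T\}$ and $\mathrm{Shad}^i(T)=\mathrm{Shad}^{i-1}(\mathrm{Shad}(T))$. A lexsegment set is completely lexsegment if all its iterated shadows are again lexsegment sets; the ideal it generates is then called a completely lexsegment ideal. For a monomial $m$, $\nu_i(m)$ is the exponent of $x_i$ in $m$, and $\min(m)$ is the smallest $i$ with $\nu_i(m)\neq0$.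 For monomials of the same degree, $m_1<_{revlex}m_2$ if there is some $s$ with $\nu_i(m_1)=\nu_i(m_2)$ for all $i>s$ and $\nu_s(m_1)>\nu_s(m_2)$. For a monomial ideal $J$, $G(J)$ is its set of minimal monomial generators and $M(J)$ the set of all monomials in $J$. $J$ has linear quotients with respect to an ordering $m_1,\ldots,m_r$ of $G(J)$ if $(m_1,\ldots,m_{i-1}):(m_i)$ is generated by a set of variables for all $i\geq 2$; then $\mathrm{set}(m_i)=\{j : x_j\in(m_1,\ldots,m_{i-1}):(m_i)\}$ (with $\mathrm{set}(m_1)=\emptyset$), and the decomposition function $g:M(J)\to G(J)$ is defined by $g(w)=m_j$, where $j$ is the smallest index with $w\in(m_1,\ldots,m_j)$. It is known that, under the hypotheses of the claim, $u=x_1x_{l+1}^{a_{l+1}}\cdots x_n^{a_n}$ and $v=x_lx_n^{d-1}$ for some (unique) $l$ with $2\leq l\leq n-1$, and that $I^k$ has linear quotients with respect to the increasing reverse lexicographical order of $G(I^k)$ (generators listed so that $m_1<_{revlex}m_2<_{revlex}\cdots$), for every $k\geq1$. The sets $\mathrm{set}(m)$ for $m\in G(I^k)$ and the function $g$ are taken with respect to this order. For this $l$, every monomial $m\in S$ is written uniquely as $m=\overline{m}\,\tilde{m}$ with $\overline{m}\in K[x_1,\ldots,x_l]$ and $\tilde{m}\in K[x_{l+1},\ldots,x_n]$. On monomials of degree $kd$: $m_1\prec m_2$ if $\deg(\overline{m_1})<\deg(\overline{m_2})$, or $\deg(\overline{m_1})=\deg(\overline{m_2})$ and $m_1<_{lex}m_2$;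 and $m_1\succeq m_2$ means $m_2\prec m_1$ or $m_1=m_2$. *)

(* Defs.v *)
From HB Require Import structures.
From mathcomp Require Import all_boot all_order all_algebra.
From mathcomp.multinomials Require Import mpoly.

Set Implicit Arguments.
Unset Strict Implicit.
Unset Printing Implicit Defensive.

Import GRing.Theory.
Local Open Scope ring_scope.

                                                                            
                                                                              
                                                        

Section MonomialOrders.
Variable n : nat.
Implicit Types m : 'X_{1..n}.

                                                                              
                                                            
Definition lexlt m1 m2 : bool :=
  [exists s : 'I_n, (m1 s < m2 s)%N && [forall i : 'I_n, (i < s)%N ==> (m1 i == m2 i)]].

Definition lexle m1 m2 : bool := (m1 == m2) || lexlt m1 m2.

                                                                              
                      
Definition revlexlt m1 m2 : bool :=
  [exists s : 'I_n, (m2 s < m1 s)%N && [forall i : 'I_n, (s < i)%N ==> (m1 i == m2 i)]].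

End MonomialOrders.

Section Lexsegments.
Variable n : nat.
Implicit Types T : 'X_{1..n} -> Prop.

Definition lexseg (u v : 'X_{1..n}) : 'X_{1..n} -> Prop :=
  fun w => [&& mdeg w == mdeg u, lexle v w & lexle w u].

Definition shad T : 'X_{1..n} -> Prop :=
  fun w => exists (i : 'I_n) (w' : 'X_{1..n}), T w' /\ w = (U_(i) + w')%MM.

Definition is_lexseg T : Prop :=
  exists u v : 'X_{1..n},
    [/\ mdeg u = mdeg v, lexle v u & forall w, T w <-> lexseg u v w].

Definition completely_lexseg T : Prop :=
  forall i : nat, is_lexseg (iter i shad T).

End Lexsegments.

Section Ideals.
Variables (n : nat) (K : fieldType).
Local Notation S := {mpoly K[n]}.
Implicit Types (P J : S -> Prop) (T : 'X_{1..n} -> Prop).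

Definition ideal_gen P : S -> Prop := fun p =>
  exists s : seq (S * S),
    (forall q, q \in s -> P q.2) /\ p = \sum_(q <- s) q.1 * q.2.

Definition mon_ideal T : S -> Prop :=
  ideal_gen (fun p => exists2 m, T m & p = 'X_[m]).

Definition ideal_exp J (k : nat) : S -> Prop :=
  ideal_gen (fun p => exists f : 'I_k -> S, (forall i, J (f i)) /\ p = \prod_(i < k) f i).

Definition colon J (q : S) : S -> Prop := fun p => J (p * q).

Definition completely_lexseg_ideal J : Prop :=
  exists T, completely_lexseg T /\ (forall p, J p <-> mon_ideal T p).

                           
                                                                    
                                                                     
                                                                            
                                                                 
                                                                           
                            
Definition linear_resolution J : Prop :=
  exists (d : nat) (b : nat -> nat) (eps : 'cV[S]_(b 0%N))
         (phi : forall i, 'M[S]_(b i.+1, b i)),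
  [/\ forall r, eps r 0 \is d.-homog,
      forall i r c, phi i r c \is 1.-homog,
      forall p, J p <-> exists x : 'rV[S]_(b 0%N), p = (x *m eps) 0 0,
      forall x : 'rV[S]_(b 0%N),
        x *m eps = 0 <-> exists y : 'rV[S]_(b 1%N), x = y *m phi 0%N
    & forall i (x : 'rV[S]_(b i.+1)),
        x *m phi i = 0 <-> exists y : 'rV[S]_(b i.+2), x = y *m phi i.+1].

Definition monomials_of J : 'X_{1..n} -> Prop := fun m => J 'X_[m].

Definition min_gens J : 'X_{1..n} -> Prop := fun m =>
  monomials_of J m /\
  (forall m', monomials_of J m' -> (m' <= m)%MM -> m' = m).

                                                                             
                                     
Definition revlex_listing J (ms : seq 'X_{1..n}) : Prop :=
  (forall m, m \in ms <-> min_gens J m) /\ sorted (@revlexlt n) ms.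

Definition prefix_ideal (ms : seq 'X_{1..n}) (j : nat) : S -> Prop :=
  mon_ideal (fun m => m \in take j ms).

Definition lq_set (ms : seq 'X_{1..n}) (m : 'X_{1..n}) : 'I_n -> Prop :=
  fun j => colon (prefix_ideal ms (index m ms)) 'X_[m] 'X_j.

                                                                                     
Definition decomposition_function J (ms : seq 'X_{1..n})
    (g : 'X_{1..n} -> 'X_{1..n}) : Prop :=
  forall w, monomials_of J w ->
    exists j : nat,
      [/\ (j < size ms)%N, g w = nth 0%MM ms j, prefix_ideal ms j.+1 'X_[w]
        & forall i, (i < j)%N -> ~ prefix_ideal ms i.+1 'X_[w]].

End Ideals.

Section Splitting.
Variable n : nat.
Implicit Types (m : 'X_{1..n.+1}) (l : 'I_n.+1).

                                                             
Definition mmin m : 'I_n.+1 := head ord0 [seq i <- enum 'I_n.+1 | m i != 0%N].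

Definition bar l m : 'X_{1..n.+1} :=
  [multinom (if (i <= l)%N then m i else 0%N) | i < n.+1].

Definition tilde l m : 'X_{1..n.+1} :=
  [multinom (if (l < i)%N then m i else 0%N) | i < n.+1].

Definition prec l m1 m2 : bool :=
  (mdeg (bar l m1) < mdeg (bar l m2))%N
  || (mdeg (bar l m1) == mdeg (bar l m2)) && lexlt m1 m2.

Definition succeq l m1 m2 : bool := prec l m2 m1 || (m1 == m2).

End Splitting.

(* Main.v *)
Require Import Defs.
From HB Require Import structures.
From mathcomp Require Import all_boot all_order all_algebra.
From mathcomp.multinomials Require Import mpoly.
From mathcomp Require Import zify.

(* Number the variables x_0, ..., x_n and let l = min(v).
   Shape of u and v.  Let p be a generator divisible by x_0 and q one that is
   not.  Linearity of the first syzygies gives generators x_0 w and x_i w with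
   i > 0 and x_0 x_i w dividing lcm(p, q), provided x_0 divides this lcm only
   once.  With p = x_0 x_n^(d-1) and q = v this yields x_0 v / x_l <= u.  If
   some x_0^2 or x_i with 0 < i <= l divides u, it follows that every w < v of
   degree d has x_0 w / x_i <= u for some i > 0, which makes L(u, v) completely
   lexsegment.  Otherwise q = x_l^2 x_n^(d-2) is a generator, and this choice
   forces v = x_l x_n^(d-1).
   Decomposition function.  A monomial m of degree kd is a generator of I^k iff
   its degree in x_0, ..., x_l is at least k and m is divisible by a product of
   m_0 monomials w in x_(l+1), ..., x_n with x_0 w in L(u, v).  As g(x_s m) is
   x_s m / x_i for the smallest i making this a generator, and the comparison
   with v^k only tests whether the degree in x_0, ..., x_l is at least k, the
   formula for g is read off this description. *)

Set Implicit Arguments.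
Unset Strict Implicit.
Unset Printing Implicit Defensive.

Import Order.TTheory GRing.Theory.
Local Open Scope ring_scope.

(** * The lexicographic order on monomials of equal degree *)

Section LexOrder.
Variable n : nat.
Implicit Types a b c m w : 'X_{1..n}.

Lemma mnm1nE (i j : 'I_n) : U_(i)%MM j = ((i : nat) == j) :> nat.
Proof. exact: mnm1E. Qed.

Lemma lexltP a b :
  reflect (exists2 s : 'I_n, (a s < b s)%N & forall i : 'I_n, (i < s)%N -> a i = b i)
          (lexlt a b).
Proof.
apply: (iffP existsP) => [[s /andP[lt_s /forallP eq_s]]|[s lt_s eq_s]].
  by exists s => // i lt_is; apply/eqP; move/implyP: (eq_s i); apply.
exists s; rewrite lt_s /=; apply/forallP => i; apply/implyP => /eq_s ->.
exact: eqxx.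
Qed.

Lemma lexltE a b : mdeg a = mdeg b -> lexlt a b = (a < b)%O.
Proof.
move=> eq_d; apply/lexltP/(ltmcP eq_d) => [[s lt_s eq_s]|[s eq_s lt_s]];
  by exists s.
Qed.

Lemma lexleE a b : mdeg a = mdeg b -> lexle a b = (a <= b)%O.
Proof. by move=> eq_d; rewrite le_eqVlt -lexltE. Qed.

Lemma lexle_intro a b (s : 'I_n) :
  (a s < b s)%N -> (forall i : 'I_n, (i < s)%N -> a i = b i) -> lexle a b.
Proof. by move=> lt_s eq_s; apply/orP; right; apply/lexltP; exists s. Qed.

Lemma lexNle a b : mdeg a = mdeg b -> ~~ lexle a b -> lexlt b a.
Proof. by move=> eq_d; rewrite lexleE // lexltE // -ltNge. Qed.

Lemma lexle_trans b a c : mdeg a = mdeg b -> mdeg b = mdeg c ->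
  lexle a b -> lexle b c -> lexle a c.
Proof.
move=> eq_ab eq_bc; rewrite !lexleE //; last by rewrite eq_ab.
exact: le_trans.
Qed.

Lemma lexle_add2l c a b : mdeg a = mdeg b ->
  lexle (c + a)%MM (c + b)%MM = lexle a b.
Proof. by move=> eq_d; rewrite !lexleE ?lemc_add2r // !mdegD eq_d. Qed.

Lemma lexle_add2r c a b : mdeg a = mdeg b ->
  lexle (a + c)%MM (b + c)%MM = lexle a b.
Proof. by move=> eq_d; rewrite ![(_ + c)%MM]addmC lexle_add2l. Qed.

Lemma lexle_U (i j : 'I_n) : (i <= j)%N -> lexle U_(j)%MM U_(i)%MM.
Proof.
rewrite leq_eqVlt => /orP[/eqP/val_inj->|lt_ij]; first by rewrite /lexle eqxx.
apply: (@lexle_intro _ _ i) => [|t lt_ti]; rewrite !mnm1nE; lia.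
Qed.

Lemma lem_mdeg_eq a b : (a <= b)%MM -> (mdeg b <= mdeg a)%N -> a = b.
Proof.
move=> le_ab le_d; rewrite -(submK le_ab).
suff /eqP->: (b - a)%MM == 0%MM by rewrite add0m.
by rewrite -mdeg_eq0; have := mdegD (b - a) a; rewrite submK; lia.
Qed.

End LexOrder.

(** * Supports of polynomials and monomial ideals *)

Section Support.
Variables (n : nat) (K : fieldType).
Local Notation S := {mpoly K[n]}.
Implicit Types (p q : S) (m w a b : 'X_{1..n}) (T : 'X_{1..n} -> Prop).

Lemma msuppM_split p q w : w \in msupp (p * q) ->
  exists a b, [/\ a \in msupp p, b \in msupp q & w = (a + b)%MM].
Proof. by move/msuppM_le => /allpairsP[[a b] /= [pa qb ->]]; exists a, b. Qed.

Lemma msupp_sum_split (I : eqType) (r : seq I) (F : I -> S) w :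
  w \in msupp (\sum_(i <- r) F i) -> exists2 i, i \in r & w \in msupp (F i).
Proof.
by move/msupp_sum_le/flattenP=> [s /mapP[i ri ->]]; rewrite filter_predT in ri; exists i.
Qed.

Lemma msupp_sum_ord_split k (F : 'I_k -> S) w :
  w \in msupp (\sum_(i < k) F i) -> exists i, w \in msupp (F i).
Proof. by move/msupp_sum_split=> [i _ Fi]; exists i. Qed.

Lemma mon_ideal_msupp T p w :
  mon_ideal T p -> w \in msupp p -> exists2 m, T m & (m <= w)%MM.
Proof.
move=> [s [sT ->]] /msupp_sum_split[q /sT[m Tm ->]] /msuppM_split[a [b []]] _.
by rewrite msuppX inE => /eqP-> ->; exists m => //; apply: lem_addl.
Qed.

Lemma mon_idealX T m w : T m -> (m <= w)%MM -> mon_ideal T ('X_[w] : S).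
Proof.
move=> Tm le_mw; exists [:: ('X_[w - m], 'X_[m])]; split.
  by move=> q; rewrite inE => /eqP-> /=; exists m.
by rewrite big_seq1 /= -mpolyXD submK.
Qed.

Lemma mon_idealXP T w :
  mon_ideal T ('X_[w] : S) <-> exists2 m, T m & (m <= w)%MM.
Proof.
split=> [/mon_ideal_msupp|[m]]; last exact: mon_idealX.
by apply; rewrite msuppX inE.
Qed.

Lemma mcoeffXM p (D m : 'X_{1..n}) : (m <= D)%MM -> ('X_[D - m] * p)@_D = p@_m.
Proof. by move=> le_mD; rewrite -commr_mpolyX -[RHS](mcoeffMX p (D - m)) submK. Qed.

(** Serves to split each generator of the resolution into its terms with and without x_0, since the
    entries of [eps] need not be monomials. *)
Definition restrict (P : pred 'X_{1..n}) p : S :=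
  \sum_(m <- msupp p | P m) p@_m *: 'X_[m].

Lemma mcoeff_restrict P p m : (restrict P p)@_m = p@_m *+ P m.
Proof.
rewrite raddf_sum /=; under eq_bigr => i _ do rewrite mcoeffZ mcoeffX.
have [mp|mNp] := boolP (m \in msupp p); last first.
  rewrite (memN_msupp_eq0 mNp) mul0rn big_seq_cond big1 // => i /andP[ip _].
  by case: eqP => [eq_im|_]; rewrite ?mulr0 //; rewrite eq_im (negbTE mNp) in ip.
rewrite big_mkcond (bigD1_seq m) //= eqxx mulr1 big1 => [|i /negPf->].
  by rewrite addr0; case: (P m).
by rewrite mulr0 if_same.
Qed.

Lemma msupp_restrict P p m : (m \in msupp (restrict P p)) = P m && (m \in msupp p).
Proof.
by rewrite !mcoeff_msupp mcoeff_restrict; case: (P m); rewrite ?mulr0n ?eqxx.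
Qed.

Lemma restrictC P p : restrict P p + restrict (predC P) p = p.
Proof.
by apply/mpolyP=> m; rewrite mcoeffD !mcoeff_restrict /=; case: (P m); rewrite ?addr0 ?add0r.
Qed.

End Support.

(** * Syzygies of a linear resolution *)

Section Crossing.
Variables (n : nat) (K : fieldType).
Local Notation S := {mpoly K[n.+1]}.

Lemma msupp_mulmx h k l (A : 'M[S]_(h, k)) (B : 'M[S]_(k, l)) i j w :
  w \in msupp ((A *m B) i j) ->
  exists r a m, [/\ a \in msupp (A i r), m \in msupp (B r j) & w = (a + m)%MM].
Proof.
rewrite mxE => /msupp_sum_ord_split[r /msuppM_split[a [m [am mm ->]]]].
by exists r, a, m.
Qed.

Lemma mxBE h k (A B : 'M[S]_(h, k)) i j : (A - B) i j = A i j - B i j.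
Proof. by rewrite !mxE. Qed.

(* Split eps = eps1 + eps0 according to divisibility by x_0.  Writing x^p, x^q
   in terms of eps gives a syzygy x whose pairing with eps1 has coefficient 1 at
   D; as x is a combination of the rows of the linear matrix phi, some row pairs
   with eps1 to a polynomial having a monomial E <= D in its support.  This
   monomial cancels against the pairing with eps0, and so comes from a generator
   divisible by x_0 and also from one that is not. *)
Lemma linear_resolution_crossing (T : 'X_{1..n.+1} -> Prop) d p q D :
  (forall m, T m -> mdeg m = d) ->
  linear_resolution (mon_ideal T : S -> Prop) ->
  T p -> T q -> (0 < p ord0)%N -> q ord0 = 0%N ->
  (p <= D)%MM -> (q <= D)%MM -> D ord0 = 1%N ->
  exists m m' (i : 'I_n.+1),
    [/\ T m, T m' /\ m' ord0 = 0%N, i != ord0,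
        (m + U_(i) = m' + U_(ord0))%MM & (m' + U_(ord0) <= D)%MM].
Proof.
move=> T_deg [e [b [eps [phi [eps_hom phi_hom eps_gen eps_ker _]]]]].
move=> Tp Tq p0 q0 pD qD D0.
have eps_above r m : m \in msupp (eps r 0) -> exists2 t, T t & (t <= m)%MM.
  apply: mon_ideal_msupp; apply/eps_gen; exists (delta_mx 0 r).
  by rewrite -rowE mxE.
have mem_gen t : T t -> exists x : 'rV[S]_(b 0), 'X_[t] = (x *m eps) 0 0.
  by move=> Tt; apply/eps_gen; apply: (mon_idealX _ Tt); apply: lepm_refl.
have [alpha alphaE] := mem_gen p Tp.
have [beta betaE] := mem_gen q Tq.
(* The degree [e] of the resolution is not assumed to be [d]. Once e <= d, a monomial of [eps],
   being divisible by an element of T of degree d, equals that element. *)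
have le_ed : (e <= d)%N.
  have: p \in msupp ((alpha *m eps) 0 0) by rewrite -alphaE msuppX inE.
  move=> /msupp_mulmx[r [a [m [_ mr pE]]]].
  by rewrite -(T_deg p Tp) pE mdegD (dhomog_mf (eps_hom r) mr) leq_addl.
have epsT r m : m \in msupp (eps r 0) -> T m.
  move=> mr; have [t Tt le_tm] := eps_above _ _ mr.
  rewrite -(lem_mdeg_eq le_tm) // (T_deg t Tt).
  by rewrite (dhomog_mf (eps_hom r) mr).
pose has0 m := (0 < (m : 'X_{1..n.+1}) ord0)%N.
pose eps1 : 'cV[S]_(b 0) := \col_r restrict has0 (eps r 0).
pose eps0 : 'cV[S]_(b 0) := \col_r restrict (predC has0) (eps r 0).
have epsE : eps = eps1 + eps0.
  by apply/matrixP=> r c; rewrite (ord1 c) !mxE restrictC.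
have eps1P r m : m \in msupp (eps1 r 0) -> T m /\ (0 < m ord0)%N.
  by rewrite mxE msupp_restrict => /andP[m0 /epsT].
have eps0P r m : m \in msupp (eps0 r 0) -> T m /\ m ord0 = 0%N.
  rewrite mxE msupp_restrict /= /has0 -leqNgt leqn0.
  by move=> /andP[/eqP m0 /epsT].
pose x := 'X_[D - p] *: alpha - 'X_[D - q] *: beta.
have /eps_ker[y xE] : x *m eps = 0.
  apply/matrixP=> r c; rewrite (ord1 r) (ord1 c) mulmxBl -!scalemxAl.
  transitivity ('X_[D - p] * (alpha *m eps) 0 0 - 'X_[D - q] * (beta *m eps) 0 0).
    by rewrite !mxE.
  by rewrite -alphaE -betaE -!mpolyXD !submK // subrr mxE.
(* A monomial of [eps0] dividing p has the degree of p, so it would equal p, yet it lacks x_0. *)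
have alpha1 : ((alpha *m eps1) 0 0)@_p = 1.
  have -> : eps1 = eps - eps0 by rewrite epsE addrK.
  rewrite mulmxBr mxBE -alphaE mcoeffB mcoeffX eqxx.
  suff /memN_msupp_eq0-> : p \notin msupp ((alpha *m eps0) 0 0) by rewrite subr0.
  apply/negP => /msupp_mulmx[r [a [m [_ /eps0P[Tm m0] pE]]]].
  have /(lem_mdeg_eq (a := m)) eq_mp : (m <= p)%MM by rewrite pE lem_addl.
  by rewrite -eq_mp ?m0 // in p0; rewrite (T_deg _ Tm) (T_deg _ Tp).
have beta1 : ((beta *m eps1) 0 0)@_q = 0.
  apply/memN_msupp_eq0/negP => /msupp_mulmx[r [a [m [_ /eps1P[_ m0] qE]]]].
  by move: q0; rewrite qE mnmDE; lia.
have: D \in msupp ((x *m eps1) 0 0).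
  rewrite mcoeff_msupp mulmxBl -!scalemxAl.
  have -> : ('X_[D - p] *: (alpha *m eps1) - 'X_[D - q] *: (beta *m eps1)) 0 0 =
            'X_[D - p] * (alpha *m eps1) 0 0 - 'X_[D - q] * (beta *m eps1) 0 0.
    by rewrite !mxE.
  rewrite mcoeffB.
  by rewrite !mcoeffXM // alpha1 beta1 subr0 oner_neq0.
rewrite xE -mulmxA => /msupp_mulmx[j [t [E [_ Ez DE]]]].
have phi_eps : phi 0%N *m eps = 0.
  apply/row_matrixP => i; rewrite row_mul row0.
  by apply/eps_ker; exists (delta_mx 0 i); rewrite -rowE.
have Ez0 : E \in msupp ((phi 0%N *m eps0) j 0).
  have -> : eps0 = eps - eps1 by rewrite epsE addrC addKr.
  by rewrite mulmxBr phi_eps mxBE mxE sub0r (perm_mem (msuppN _)).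
have ED : (E <= D)%MM by rewrite DE lem_addl.
have [r [a [m [ar /eps1P[Tm m0] EmE]]]] := msupp_mulmx Ez.
have [r' [a' [m' [ar' /eps0P[Tm' m'0] Em'E]]]] := msupp_mulmx Ez0.
have /eqP/mdeg1P[i /eqP aE] := dhomog_mf (phi_hom 0%N j r) ar.
have /eqP/mdeg1P[i' /eqP a'E] := dhomog_mf (phi_hom 0%N j r') ar'.
(* As [D] contains x_0 once, so does [E]. Hence the linear factor beside [m] is not x_0, and the one
   beside [m'], which lacks x_0, is x_0. *)
have E0 : E ord0 = 1%N.
  have := mnm_lepP ED ord0; rewrite D0 EmE mnmDE.
  lia.
have i'0 : i' = ord0.
  apply/val_inj => /=; move: E0; rewrite Em'E a'E mnmDE mnm1nE m'0.
  by rewrite -[X in _ == X]/0%N; lia.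
exists m, m', i; split=> //.
- apply/eqP => i0; move: E0; rewrite EmE aE i0 mnmDE mnm1E eqxx; lia.
- by rewrite -i'0 -a'E -aE addmC -EmE Em'E addmC.
- by rewrite -i'0 -a'E addmC -Em'E.
Qed.

End Crossing.

(** * The smallest variable of a monomial *)

Section MinimalVariable.
Variable n : nat.
Implicit Types (m w : 'X_{1..n.+1}) (l : 'I_n.+1).

Lemma mmin_first m (i : 'I_n.+1) : m i != 0%N ->
  m (mmin m) != 0%N /\ (mmin m <= i)%N.
Proof.
move=> mi; rewrite /mmin.
have: i \in [seq j <- enum 'I_n.+1 | m j != 0%N] by rewrite mem_filter mi mem_enum.
have: sorted (relpre val ltn) [seq j <- enum 'I_n.+1 | m j != 0%N].
  apply: sorted_filter; first by move=> a b c; apply: ltn_trans.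
  by rewrite -sorted_map val_enum_ord iota_ltn_sorted.
have: all (fun j => m j != 0%N) [seq j <- enum 'I_n.+1 | m j != 0%N] by exact: filter_all.
case: [seq j <- _ | _] => [|j r] //= /andP[mj _] /order_path_min.
move=> /(_ (fun a b c => @ltn_trans (val a) (val b) (val c))) /allP lt_j.
by rewrite inE => /orP[/eqP->|/lt_j /ltnW].
Qed.

Lemma mnm_supp m : (0 < mdeg m)%N -> exists i, m i != 0%N.
Proof.
move=> m_pos; apply/existsP; apply: contraLR m_pos; rewrite negb_exists => /forallP m0.
by rewrite mdegE big1 // => i _; apply/eqP; move: (m0 i); rewrite negbK.
Qed.

Lemma mminP m : (0 < mdeg m)%N ->
  m (mmin m) != 0%N /\ forall i : 'I_n.+1, (i < mmin m)%N -> m i = 0%N.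
Proof.
move=> /mnm_supp[i /mmin_first[mm _]]; split=> // j lt_j.
by apply/eqP; apply: contraTT lt_j => /mmin_first[_]; rewrite -leqNgt.
Qed.

Lemma subUK m (i : 'I_n.+1) : m i != 0%N -> (m - U_(i) + U_(i))%MM = m.
Proof.
move=> mi; apply: submK; apply/mnm_lepP => j; rewrite mnm1E.
by case: eqP => // <-; rewrite lt0n.
Qed.

Lemma mdeg_subU m (i : 'I_n.+1) : m i != 0%N -> mdeg (m - U_(i))%MM = (mdeg m).-1.
Proof. by move=> /subUK <-; rewrite addmK mdegD mdeg1 addn1. Qed.

End MinimalVariable.

(** * Complete lexsegments and their shadows *)

Section Complete.
Variable n : nat.
Implicit Types (u v w : 'X_{1..n.+1}).

(* The criterion of De Negri and Herzog for complete lexsegments. *)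
Definition liftable u v := forall w, mdeg w = mdeg v -> lexlt w v ->
  exists i : 'I_n.+1, [/\ i != ord0, w i != 0%N & lexle (U_(ord0) + w - U_(i))%MM u].

Lemma lexlt_ord0 u v : (v ord0 < u ord0)%N -> lexle v u.
Proof. by move=> lt_vu; apply: (@lexle_intro _ _ _ ord0). Qed.

Lemma lexle_ord0 u v : lexle v u -> (v ord0 <= u ord0)%N.
Proof.
case/orP=> [/eqP->//|/lexltP[s lt_s eq_s]].
case: (posnP s) => [s0|s_pos]; last by rewrite eq_s.
have <- : s = ord0 by apply: val_inj.
exact: ltnW.
Qed.

(** A monomial w < v has no x_0, so x_0 w / x_i contains x_0 once, fewer times than u; any x_i
    dividing w will do. *)
Lemma liftable_ord0 u v : (1 < u ord0)%N -> v ord0 = 0%N -> (0 < mdeg v)%N ->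
  liftable u v.
Proof.
move=> u0 v0 v_pos w w_deg /lexltP lt_wv.
have w0 : w ord0 = 0%N.
  by apply/eqP; rewrite -leqn0 -v0; apply: lexle_ord0; apply/orP; right; apply/lexltP.
have [|i wi] := @mnm_supp _ w; first by rewrite w_deg.
have i0 : i != ord0 by apply: contraNneq wi => ->; rewrite w0.
exists i; split=> //; apply: lexlt_ord0.
rewrite mnmBE mnmDE !mnm1nE w0 eqxx; lia.
Qed.

(** Divide by the last variable x_i of w. If w / x_i < v, the first difference lies either before i,
    which would make w < x_n v, or at or after i, and then w / x_i divides v and has its degree. *)
Lemma lexle_divide_max v w : mdeg w = (mdeg v).+1 ->
  lexle (U_(ord_max) + v)%MM w ->
  exists i : 'I_n.+1, w i != 0%N /\ lexle v (w - U_(i))%MM.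
Proof.
move=> w_deg le_vw.
have [i0 wi0] : exists i, w i != 0%N by apply: mnm_supp; rewrite w_deg.
have [i wi max_i] := @arg_maxnP _ i0 (fun i => w i != 0%N) (@nat_of_ord _) wi0.
exists i; split=> //; set w' := (w - U_(i))%MM.
have w'_deg : mdeg w' = mdeg v by rewrite mdeg_subU // w_deg.
have w'0 (j : 'I_n.+1) : (i < j)%N -> w' j = 0%N.
  move=> lt_ij; rewrite mnmBE; suff -> : w j = 0%N by [].
  by apply/eqP; apply: contraTT lt_ij => /max_i; rewrite -leqNgt.
have wE : w = (w' + U_(i))%MM by rewrite subUK.
apply: contraT => /lexNle-/(_ (esym w'_deg))/lexltP[s lt_s eq_s].
have [lt_si|le_is] := ltnP s i.
  have : lexlt w (U_(ord_max) + v)%MM.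
    apply/lexltP; exists s => [|j lt_js]; rewrite wE !mnmDE !mnm1nE /=.
      by move: lt_s (ltn_ord i) => /=; lia.
    have := eq_s j lt_js; have := ltn_ord i; lia.
  have w_deg' : mdeg w = mdeg (U_(ord_max) + v)%MM by rewrite mdegD mdeg1 w_deg.
  by move: le_vw; rewrite (lexltE w_deg') lexleE // leNgt => /negP.
have le_w'v : (w' <= v)%MM.
  apply/mnm_lepP => j; have [/eq_s->//|le_sj] := ltnP j s.
  move: le_sj; rewrite leq_eqVlt => /orP[/eqP/val_inj<-|lt_sj]; first exact: ltnW.
  by rewrite w'0 //; apply: leq_ltn_trans lt_sj.
by move: lt_s; rewrite (lem_mdeg_eq le_w'v) ?w'_deg // ltnn.
Qed.

(** For the converse inclusion, a monomial w without x_0 is divided by its last variable. Otherwise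
    w = x_0 w', and either w' >= v lies in the segment, or w' < v and [liftable] replaces it by x_0
    w' / x_i. *)
Lemma shad_lexseg u v : mdeg u = mdeg v -> v ord0 = 0%N -> (0 < u ord0)%N ->
  liftable u v ->
  forall w, shad (lexseg u v) w <-> lexseg (U_(ord0) + u)%MM (U_(ord_max) + v)%MM w.
Proof.
move=> uv_deg v0 u0 lift w; split=> [[i [w' [/and3P[/eqP w'_deg le_vw' le_w'u] ->]]]|].
  apply/and3P; split; first by rewrite !mdegD !mdeg1 w'_deg.
    apply: (@lexle_trans _ (U_(i) + v)%MM); rewrite ?mdegD ?mdeg1 ?w'_deg ?uv_deg //.
      by rewrite lexle_add2r ?mdeg1 // lexle_U // -ltnS ltn_ord.
    by rewrite lexle_add2l ?w'_deg ?uv_deg.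
  apply: (@lexle_trans _ (U_(i) + u)%MM); rewrite ?mdegD ?mdeg1 ?w'_deg ?uv_deg //.
    by rewrite lexle_add2l.
  by rewrite lexle_add2r ?mdeg1 // lexle_U.
move=> /and3P[/eqP]; rewrite mdegD mdeg1 add1n => w_deg le_vw le_wu.
have [w0|w0] := eqVneq (w ord0) 0%N.
  have [|i [wi le_vwi]] := lexle_divide_max _ le_vw; first by rewrite w_deg uv_deg.
  exists i, (w - U_(i))%MM; split; last by rewrite addmC subUK.
  apply/and3P; split=> //; first by rewrite mdeg_subU // w_deg.
  by apply: lexlt_ord0; rewrite mnmBE w0.
have wE := subUK w0; set w' := (w - U_(ord0))%MM in wE.
have w'_deg : mdeg w' = mdeg u by rewrite mdeg_subU // w_deg.
have le_w'u : lexle w' u.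
  by rewrite -(lexle_add2l U_(ord0)%MM) // addmC wE.
have [le_vw'|] := boolP (lexle v w').
  exists ord0, w'; split; last by rewrite addmC.
  by apply/and3P; split=> //; rewrite w'_deg.
move/lexNle; rewrite w'_deg uv_deg => /(_ erefl) lt_w'v.
have [|i [i0 w'i le_iu]] := lift w' _ lt_w'v; first by rewrite w'_deg.
have w'i' : (U_(ord0) + w')%MM i != 0%N by rewrite mnmDE addn_eq0 negb_and w'i orbT.
exists i, (U_(ord0) + w' - U_(i))%MM; split; last first.
  by rewrite [RHS]addmC subUK // addmC wE.
apply/and3P; split=> //; first by rewrite mdeg_subU // mdegD mdeg1 w'_deg.
apply: lexlt_ord0; rewrite v0 mnmBE mnmDE !mnm1nE eqxx.
have : (i : nat) != 0%N by [].
rewrite [X in (_ + _ - (_ == X))%N]/=; lia.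
Qed.

(** [lift] handles the first shadow; later upper ends contain x_0 at least twice, so [liftable_ord0]
    applies. *)
Lemma iter_shad_lexseg u v i : mdeg u = mdeg v -> v ord0 = 0%N -> (0 < u ord0)%N ->
  liftable u v ->
  forall w, iter i (@shad n.+1) (lexseg u v) w <->
    lexseg (U_(ord0) *+ i + u)%MM (U_(ord_max) *+ i + v)%MM w.
Proof.
move=> uv_deg v0 u0 lift.
have v_pos : (0 < mdeg v)%N.
  by rewrite -uv_deg lt0n mdeg_eq0; apply: contraTneq u0 => ->; rewrite mnm0E.
(* With x_n different from x_0, the lower end x_n^i v stays free of x_0. *)
have n_pos : (0 < n)%N.
  have [j vj] := mnm_supp v_pos; have := ltn_ord j.
  have : (j : nat) != 0%N.
    by apply: contraNneq vj => j0; rewrite -v0; apply/eqP; congr (v _); apply: val_inj.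
  lia.
elim: i => [|i IH] w; first by rewrite /= !mulm0n !add0m.
have -> : iter i.+1 (@shad n.+1) (lexseg u v) w <->
    shad (lexseg (U_(ord0) *+ i + u)%MM (U_(ord_max) *+ i + v)%MM) w.
  by split=> -[j [w' [/IH Tw' ->]]]; exists j, w'.
have v'0 : (U_(ord_max) *+ i + v)%MM ord0 = 0%N.
  by rewrite mnmDE mulmnE mnm1nE v0 /= gtn_eqF.
rewrite shad_lexseg.
- by rewrite !mulmS !addmA.
- by rewrite !mdegD !mdegMn !mdeg1 uv_deg.
- exact: v'0.
- by rewrite mnmDE ltn_addl.
case: i {IH} v'0 => [|i] v'0; first by rewrite !mulm0n !add0m.
apply: liftable_ord0 => //; last by rewrite mdegD; lia.
by rewrite mnmDE mulmnE mnm1E eqxx; lia.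
Qed.

Lemma liftable_completely_lexseg u v :
  mdeg u = mdeg v -> v ord0 = 0%N -> (0 < u ord0)%N -> liftable u v ->
  completely_lexseg (lexseg u v).
Proof.
move=> uv_deg v0 u0 lift i.
exists (U_(ord0) *+ i + u)%MM, (U_(ord_max) *+ i + v)%MM.
have d_eq : mdeg (U_(ord0) *+ i + u)%MM = mdeg (U_(ord_max) *+ i + v)%MM.
  by rewrite !mdegD !mdegMn !mdeg1 uv_deg.
split=> // [|w]; last exact: iter_shad_lexseg.
apply: lexlt_ord0; rewrite !mnmDE !mulmnE !mnm1nE v0 eqxx; nia.
Qed.

End Complete.

(** * The shape of u and v *)

Section Shape.
Variable n : nat.
Implicit Types (u v w : 'X_{1..n.+1}).

Lemma ord_neq0 (i : 'I_n.+1) : i != ord0 -> (0 < i)%N.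
Proof. by rewrite lt0n. Qed.

(** A monomial below x_j x_n^k first differs from it at j or at n. The former leaves no variable up
    to j; the latter makes it a divisor of the same degree. *)
Lemma lexle_U_power (j i : 'I_n.+1) k w : mdeg w = k.+1 -> (i <= j)%N -> w i != 0%N ->
  lexle (U_(j) + U_(ord_max) *+ k)%MM w.
Proof.
move=> w_deg le_ij wi; set c := (_ + _)%MM.
have cw_deg : mdeg c = mdeg w by rewrite mdegD mdegMn !mdeg1 w_deg mul1n.
have cE t : c t = ((j == t :> nat) + (n == t :> nat) * k)%N.
  by rewrite mnmDE mulmnE !mnm1nE.
apply: contraT => /lexNle-/(_ cw_deg)/lexltP[s lt_s eq_s].
have [s_max|ns] := eqVneq (s : nat) n.
  have le_wc : (w <= c)%MM.
    apply/mnm_lepP => t; have [/eq_s->//|le_st] := ltnP t s.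
    have -> : t = s by apply: val_inj => /=; have := ltn_ord t; lia.
    exact: ltnW.
  by move: lt_s; rewrite (lem_mdeg_eq le_wc) ?cw_deg // ltnn.
have sj : (s : nat) = j by move: lt_s ns; rewrite cE; lia.
have [lt_ij|ge_ij] := ltnP i j.
  have : (i < s)%N by rewrite sj.
  move/eq_s=> wiE; move: wi; rewrite wiE cE; have := ltn_ord j; lia.
have ij : i = s by apply: val_inj => /=; lia.
by move: lt_s wi; rewrite ij cE; lia.
Qed.

(** The first difference between w and u lies beyond l: it is not at 0, and at 1, ..., l the
    exponent of u, being 0, cannot be the larger one. *)
Lemma lexle_prefix0 w u (l j : 'I_n.+1) : lexle w u -> w ord0 = u ord0 ->
  (forall i : 'I_n.+1, (0 < i <= l)%N -> u i = 0%N) -> (0 < j <= l)%N -> w j = 0%N.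
Proof.
move=> /orP[/eqP->|/lexltP[s lt_s eq_s]] w0 u_l jl; first exact: u_l.
have lt_ls : (l < s)%N.
  rewrite ltnNge; apply/negP => le_sl; case: (posnP s) => [s0|s_pos].
    have sE : s = ord0 by apply: val_inj.
    by move: lt_s; rewrite sE w0 ltnn.
  by move: lt_s; rewrite (u_l s) // s_pos.
by rewrite eq_s ?u_l //; lia.
Qed.

Lemma lexseg_deg u v w : lexseg u v w -> mdeg w = mdeg u.
Proof. by case/and3P=> /eqP. Qed.

Lemma mlcmE (a b : 'X_{1..n.+1}) i : mlcm a b i = maxn (a i) (b i).
Proof. by rewrite mnmE. Qed.

Section LinearResolution.
Variables (K : fieldType) (d : nat) (u v : 'X_{1..n.+1}).
Hypotheses (d_gt1 : (1 < d)%N) (u_deg : mdeg u = d) (v_deg : mdeg v = d).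
Hypotheses (u0 : (0 < u ord0)%N) (v0 : v ord0 = 0%N).
Hypothesis lin : linear_resolution (mon_ideal (lexseg u v) : {mpoly K[n.+1]} -> Prop).

Let l := mmin v.
Let p : 'X_{1..n.+1} := (U_(ord0) + U_(ord_max) *+ (d - 1))%MM.

Let v_pos : (0 < mdeg v)%N. Proof. by rewrite v_deg ltnW. Qed.
Let vl : v l != 0%N. Proof. by case: (mminP v_pos). Qed.
Let v_lt (i : 'I_n.+1) : (i < l)%N -> v i = 0%N.
Proof. by case: (mminP v_pos) => _; apply. Qed.
Let l_pos : (0 < l)%N.
Proof. by apply: ord_neq0; apply: contraNneq vl => ->; rewrite v0. Qed.
Let n_pos : (0 < n)%N. Proof. by have := ltn_ord l; lia. Qed.

Let pE i : p i = ((0%N == i :> nat) + (n == i :> nat) * (d - 1))%N.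
Proof. by rewrite mnmDE mulmnE !mnm1nE. Qed.

Let p_deg : mdeg p = d. Proof. by rewrite mdegD mdegMn !mdeg1; lia. Qed.

Let p_lexseg : lexseg u v p.
Proof.
apply/and3P; split; first by rewrite p_deg u_deg.
  by apply: lexlt_ord0; rewrite v0 pE.
by apply: (@lexle_U_power _ ord0); rewrite // -?lt0n // u_deg; lia.
Qed.

Let lexseg_v : lexseg u v v.
Proof.
apply/and3P; split; rewrite ?u_deg ?v_deg // /lexle ?eqxx //.
by have := lexlt_ord0 (v := v) (u := u); rewrite v0 => /(_ u0).
Qed.

Let T_deg w : lexseg u v w -> mdeg w = d.
Proof. by move/lexseg_deg->. Qed.

(* Crossing from x_0 x_n^(d-1) to v. *)
Lemma divide_min_le : lexle (U_(ord0) + (v - U_(l)))%MM u.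
Proof.
have [||m [m' [i [Tm [Tm' m'0] i0 mE le_D]]]] :=
  linear_resolution_crossing T_deg lin p_lexseg lexseg_v _ v0
    (lem_mlcml p v) (lem_mlcmr p v).
- by rewrite pE.
- by rewrite mlcmE v0 pE eqxx /= gtn_eqF.
(* Away from x_n the exponents of m' are at most those of v. So if m' > v, the first difference is
   at x_n, and v is a divisor of m' of the same degree. *)
have m'v : m' = v.
  have le_m'v (j : 'I_n.+1) : (j < n)%N -> (m' j <= v j)%N.
    move=> lt_jn; have := mnm_lepP le_D j; rewrite mlcmE pE mnmDE mnm1nE /=.
    case: (posnP j) => [j_0|]; last by lia.
    by have -> : j = ord0 by [apply: val_inj]; rewrite m'0.
  case/and3P: Tm' => /eqP m'_deg /orP[/eqP->//|/lexltP[s lt_s eq_s]] _.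
  have sn : (s : nat) = n.
    by have := le_m'v s; have := ltn_ord s; lia.
  have le_vm' : (v <= m')%MM.
    apply/mnm_lepP => t; have [/eq_s->//|le_st] := ltnP t s.
    have -> : t = s by apply: val_inj => /=; have := ltn_ord t; lia.
    exact: ltnW.
  by rewrite [RHS](lem_mdeg_eq le_vm') // m'_deg u_deg v_deg.
rewrite m'v in mE.
(* Now m = x_0 v / x_i with l <= i, so x_0 v / x_l <= m <= u. *)
have vi : v i != 0%N.
  have /mnmP/(_ i) := mE; rewrite !mnmDE !mnm1nE eqxx.
  by have := ord_neq0 i0; rewrite /=; lia.
have le_li : (l <= i)%N by case: (mmin_first vi).
have x_deg : mdeg (U_(ord0) + (v - U_(l)))%MM = d.
  by rewrite mdegD mdeg1 mdeg_subU // v_deg; lia.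
apply: (@lexle_trans _ m); rewrite ?x_deg ?u_deg ?(T_deg Tm) //; last by case/and3P: Tm.
rewrite -(lexle_add2r U_(i)%MM) ?x_deg ?(T_deg Tm) // mE.
rewrite -{2}(subUK vl) [X in lexle _ X]addmC addmA lexle_add2l ?mdeg1 //.
exact: lexle_U.
Qed.

Let supported := [forall i : 'I_n.+1, (0 < i <= l)%N ==> (u i == 0%N)].

(** When x_0 divides u only once, take i = min(w) for w < v; it is at least l. If i = l, then x_0 w
    / x_l <= x_0 v / x_l <= u. If i > l, then x_0 w / x_i has no x_1, ..., x_l, while u contains one
    of them. *)
Lemma liftable_unless_supported : ~~ ((u ord0 == 1%N) && supported) -> liftable u v.
Proof.
have [u01|u0N1 _] := eqVneq (u ord0) 1%N; last first.
  by apply: liftable_ord0 => //; move: u0 u0N1; lia.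
rewrite negb_forall /= => /existsP[i0]; rewrite negb_imply => /andP[i0l ui0].
move=> w w_deg lt_wv.
have w_pos : (0 < mdeg w)%N by rewrite w_deg.
have [wi w_lt] := mminP w_pos; set i := mmin w in wi w_lt.
have w_ltl (j : 'I_n.+1) : (j < l)%N -> w j = 0%N.
  move=> lt_jl; case/lexltP: lt_wv => s lt_s eq_s.
  have le_ls : (l <= s)%N.
    by rewrite leqNgt; apply/negP => /v_lt vs; move: lt_s; rewrite vs.
  by rewrite eq_s ?v_lt //; apply: leq_trans le_ls.
have le_li : (l <= i)%N by rewrite leqNgt; apply: contraNN wi => /w_ltl->.
have i_n0 : i != ord0 by rewrite -val_eqE /=; lia.
exists i; split=> //.
have -> : (U_(ord0) + w - U_(i))%MM = (U_(ord0) + (w - U_(i)))%MM.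
  by rewrite -{1}(subUK wi) addmA addmK.
have y_deg : mdeg (U_(ord0) + (w - U_(i)))%MM = d.
  by rewrite mdegD mdeg1 mdeg_subU // w_deg v_deg; lia.
have x_deg : mdeg (U_(ord0) + (v - U_(l)))%MM = d.
  by rewrite mdegD mdeg1 mdeg_subU // v_deg; lia.
have [il|ltli] := eqVneq i l.
  apply: (@lexle_trans _ (U_(ord0) + (v - U_(l)))%MM);
    rewrite ?y_deg ?x_deg ?u_deg //; last exact: divide_min_le.
  have wl : w l != 0%N by rewrite -il.
  have sub_deg : mdeg (w - U_(l))%MM = mdeg (v - U_(l))%MM by rewrite !mdeg_subU ?w_deg.
  rewrite il lexle_add2l // -(lexle_add2r U_(l)%MM) // !subUK //.
  by apply/orP; right.
have {}ltli : (l < i)%N by rewrite ltn_neqAle eq_sym ltli.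
have yE (j : 'I_n.+1) : (j <= l)%N ->
    (U_(ord0) + (w - U_(i)))%MM j = (0%N == j :> nat).
  by move=> le_jl; rewrite mnmDE mnmBE w_lt ?addn0 ?mnm1nE //; apply: leq_ltn_trans ltli.
apply: contraT => /lexNle; rewrite y_deg u_deg => /(_ erefl) /lexltP[s lt_s eq_s].
have [le_sl|lt_ls] := leqP s l; last first.
  by move: ui0; rewrite eq_s ?yE; lia.
move: lt_s; rewrite yE //; case: (posnP s) => [s0|]; last by lia.
by have -> : s = ord0 by [apply: val_inj]; rewrite u01.
Qed.

(* Crossing from x_0 x_n^(d-1) to x_l^2 x_n^(d-2). *)
Lemma supported_shape : u ord0 = 1%N -> supported ->
  (l < n)%N /\ v = (U_(l) + U_(ord_max) *+ (d - 1))%MM.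
Proof.
move=> u01 /forallP supp.
have u_supp (i : 'I_n.+1) : (0 < i <= l)%N -> u i = 0%N.
  by move=> il; apply/eqP; move/implyP: (supp i); apply.
(* By [divide_min_le], x_0 v / x_l <= u; both contain x_0 once, so x_0 v / x_l, like u, has no
   x_l. *)
have vl1 : v l = 1%N.
  have := lexle_prefix0 divide_min_le _ u_supp (j := l).
  rewrite mnmDE mnmBE v0 mnm1nE u01 l_pos leqnn eqxx => /(_ erefl erefl).
  by rewrite mnmDE mnmBE !mnm1nE eqxx; move: vl; lia.
(* For l = n, v would be x_n, of degree 1 < d. *)
have lt_ln : (l < n)%N.
  rewrite ltn_neqAle -ltnS ltn_ord andbT; apply/eqP => ln.
  have le_v : (v <= U_(l))%MM.
    apply/mnm_lepP => j; have [jl|] := eqVneq j l.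
      by rewrite jl vl1 mnm1E eqxx.
    move=> njl; have : (j : nat) != l by [].
    by have := ltn_ord j => ? ?; rewrite v_lt //; lia.
  by move: (v_deg) d_gt1; rewrite (lem_mdeg_eq le_v) ?mdeg1 //; lia.
split=> //.
pose q : 'X_{1..n.+1} := (U_(l) *+ 2 + U_(ord_max) *+ (d - 2))%MM.
have qE i : q i = ((l == i :> nat) * 2 + (n == i :> nat) * (d - 2))%N.
  by rewrite mnmDE !mulmnE !mnm1nE.
have q0 : q ord0 = 0%N by rewrite qE /=; lia.
have Tq : lexseg u v q.
  apply/and3P; split; first by rewrite u_deg mdegD !mdegMn !mdeg1; lia.
    apply: (@lexle_intro _ _ _ l) => [|j lt_jl]; first by rewrite vl1 qE eqxx; lia.
    by rewrite v_lt // qE; lia.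
  by apply: lexlt_ord0; rewrite q0.
have [||m [m' [i [Tm [Tm' m'0] i0 mE le_D]]]] :=
  linear_resolution_crossing T_deg lin p_lexseg Tq _ q0
    (lem_mlcml p q) (lem_mlcmr p q).
- by rewrite pE.
- by rewrite mlcmE q0 pE eqxx /= gtn_eqF.
have i_pos := ord_neq0 i0.
have m0 : m ord0 = 1%N.
  by have /mnmP/(_ ord0) := mE; rewrite !mnmDE !mnm1nE m'0 eqxx /=; lia.
have DE j : mlcm p q j = maxn (p j) (q j) by exact: mlcmE.
(* Here D = x_0 x_l^2 x_n^(d-1). As m <= u contains x_0 once, it has no x_1, ..., x_l, so it divides
   p. *)
have mp : m = p.
  apply: lem_mdeg_eq; last by rewrite p_deg (T_deg Tm).
  apply/mnm_lepP => j; case: (posnP j) => [j_0|j_pos].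
    by have -> : j = ord0 by [apply: val_inj]; rewrite m0 pE eqxx.
  have [le_jl|lt_lj] := leqP j l.
    rewrite (@lexle_prefix0 m u l) ?m0 ?u01 //; last by rewrite j_pos.
    by case/and3P: Tm.
  have := mnm_lepP le_D j; rewrite -mE DE pE qE mnmDE; lia.
(* So x_0 m' = x_i p. For i = l this gives m' = x_l x_n^(d-1), which is at most v because x_l
   divides v, and at least v as a generator. For i = n it would give m' = x_n^d < v. *)
have [il|nil] := eqVneq i l.
  have m'E : m' = (U_(l) + U_(ord_max) *+ (d - 1))%MM.
    apply: (@addIm _ U_(ord0)%MM); rewrite -mE mp il /p.
    by apply/mnmP => j; rewrite !mnmDE; lia.
  rewrite -m'E; case/and3P: Tm' => _ le_vm' _; apply/eqP.
  have m'_deg : mdeg m' = mdeg v by rewrite m'E mdegD mdegMn !mdeg1 v_deg; lia.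
  rewrite eq_le -!lexleE // le_vm' m'E.
  by apply: (lexle_U_power (i := l)) => //; rewrite v_deg; lia.
have i_max : (i : nat) = n.
  have := mnm_lepP le_D i; rewrite -mE DE pE qE mnmDE mnm1nE eqxx.
  by have : (i : nat) != l by []; lia.
have m'E j : (m' j + (0%N == j :> nat) = p j + (n == j :> nat))%N.
  by have /mnmP/(_ j) := mE; rewrite mp !mnmDE !mnm1nE i_max.
case/and3P: Tm' => m'_deg le_vm' _.
have : lexlt m' v.
  apply/lexltP; exists l => [|j lt_jl]; have := m'E l.
    by rewrite pE vl1; lia.
  by have := m'E j; rewrite (v_lt lt_jl) pE; lia.
by rewrite lexltE ?v_deg -?u_deg ?(eqP m'_deg) // ltNge -lexleE ?le_vm' // v_deg -u_deg (eqP m'_deg).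
Qed.

Lemma lexseg_shape : ~ completely_lexseg (lexseg u v) ->
  exists l : 'I_n.+1,
    [/\ (0 < l < n)%N, u ord0 = 1%N, forall i : 'I_n.+1, (0 < i <= l)%N -> u i = 0%N
      & v = (U_(l) + U_(ord_max) *+ (d - 1))%MM].
Proof.
move=> not_complete; exists l.
have [/andP[/eqP u01 supp]|] := boolP ((u ord0 == 1%N) && supported); last first.
  move/liftable_unless_supported => lift; case: not_complete.
  by apply: liftable_completely_lexseg; rewrite // u_deg.
have [ln vE] := supported_shape u01 supp.
split=> //; first by rewrite l_pos.
by move=> i il; apply/eqP; move/forallP: supp => /(_ i)/implyP; apply.
Qed.

End LinearResolution.
End Shape.

(** * Powers of monomial ideals and their minimal generators *)

Section Products.
Variable n : nat.
Implicit Types (T : 'X_{1..n} -> Prop) (m w : 'X_{1..n}).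

(** Stated for any T as it serves both for L(u, v) and for [tails]; the recursion lets one factor be
    peeled off at a time. *)
Fixpoint products T k w : Prop :=
  if k is k'.+1 then exists a b, [/\ T a, products T k' b & w = (a + b)%MM]
  else w = 0%MM.

Lemma products_mdeg T d k w :
  (forall m, T m -> mdeg m = d) -> products T k w -> mdeg w = (k * d)%N.
Proof.
move=> T_deg; elim: k w => [|k IH] w /= => [->|[a [b [/T_deg a_deg /IH b_deg ->]]]].
  by rewrite mdeg0.
by rewrite mdegD a_deg b_deg mulSn.
Qed.

Variable K : fieldType.
Local Notation S := {mpoly K[n]}.

Lemma msupp_prod_products T k (f : 'I_k -> S) w :
  (forall i, mon_ideal T (f i)) -> w \in msupp (\prod_(i < k) f i) ->
  exists2 b, products T k b & (b <= w)%MM.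
Proof.
elim: k f w => [|k IH] f w f_T.
  rewrite big_ord0 msupp1 inE => /eqP->; exists 0%MM => //; exact: lepm_refl.
rewrite big_ord_recl => /msuppM_split[a [c [/(mon_ideal_msupp (f_T _))[a' Ta' le_a]]]].
case/IH => [i|b Tb le_b ->]; first exact: f_T.
exists (a' + b)%MM; first by exists a', b.
by apply/mnm_lepP => i; rewrite !mnmDE leq_add // (mnm_lepP _).
Qed.

Lemma products_prod T k b : products T k b ->
  exists f : 'I_k -> S, (forall i, mon_ideal T (f i)) /\ 'X_[b] = \prod_(i < k) f i.
Proof.
elim: k b => [|k IH] b /= => [->|[a [c [Ta /IH[f [f_T fE]] ->]]]].
  (* ['I_0] is empty, so the value 0 is never taken. *)
  by exists (fun=> 0); split=> [[]|] //; rewrite big_ord0 mpolyX0.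
exists (fun i => if unlift ord0 i is Some j then f j else 'X_[a]); split.
  move=> i; case: unliftP => [j _|_]; first exact: f_T.
  exact: (mon_idealX _ Ta (lepm_refl a)).
rewrite big_ord_recl unlift_none mpolyXD fE; congr (_ * _).
by apply: eq_bigr => i _; rewrite liftK.
Qed.

Lemma ideal_expXP T k w :
  ideal_exp (mon_ideal T : S -> Prop) k 'X_[w] <->
  exists2 b, products T k b & (b <= w)%MM.
Proof.
split=> [[s [s_f wE]]|[b /products_prod[f [f_T fE]] le_bw]].
  have : w \in msupp ('X_[w] : S) by rewrite msuppX inE.
  rewrite wE => /msupp_sum_split[q /s_f[f [f_T ->]]] /msuppM_split[a [c [_ + ->]]].
  case/(msupp_prod_products f_T) => b Tb le_bc; exists b => //.
  by apply: lepm_trans le_bc (lem_addl _ _).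
exists [:: ('X_[w - b], 'X_[b])]; split.
  by move=> q; rewrite inE => /eqP-> /=; exists f.
by rewrite big_seq1 /= -mpolyXD submK.
Qed.

(** All k-fold products have degree kd, so none properly divides another. *)
Lemma min_gens_expP T d k m : (forall m, T m -> mdeg m = d) ->
  min_gens (ideal_exp (mon_ideal T : S -> Prop) k) m <-> products T k m.
Proof.
move=> T_deg; split=> [[/ideal_expXP[b Tb le_bm] m_min]|Tm].
  by rewrite -(m_min b) //; apply/ideal_expXP; exists b => //; apply: lepm_refl.
split; first by apply/ideal_expXP; exists m => //; apply: lepm_refl.
move=> m' /ideal_expXP[b Tb le_bm'] le_m'm.
have bm : b = m.
  apply: lem_mdeg_eq; first exact: lepm_trans le_m'm.
  by rewrite (products_mdeg T_deg Tb) (products_mdeg T_deg Tm).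
rewrite bm in le_bm'; apply/mnmP => i; apply/eqP.
by rewrite eqn_leq (mnm_lepP le_m'm) (mnm_lepP le_bm').
Qed.

End Products.

(** * Revlex listings and the decomposition function *)

Section Listing.
Variables (n : nat) (K : fieldType).
Implicit Types (ms : seq 'X_{1..n}) (m w : 'X_{1..n}).

Lemma revlexltP m1 m2 :
  reflect (exists2 s : 'I_n, (m2 s < m1 s)%N & forall i : 'I_n, (s < i)%N -> m1 i = m2 i)
          (revlexlt m1 m2).
Proof.
apply: (iffP existsP) => [[s /andP[lt_s /forallP eq_s]]|[s lt_s eq_s]].
  by exists s => // i lt_is; apply/eqP; move/implyP: (eq_s i); apply.
exists s; rewrite lt_s /=; apply/forallP => i; apply/implyP => /eq_s ->.
exact: eqxx.
Qed.

Lemma revlexlt_trans : transitive (@revlexlt n).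
Proof.
move=> b a c /revlexltP[s lt_s eq_s] /revlexltP[t lt_t eq_t].
apply/revlexltP; case: (ltngtP s t) => [lt_st|lt_ts|/val_inj st].
- by exists t => [|i lt_ti]; [rewrite eq_s | rewrite eq_s ?eq_t //; apply: ltn_trans lt_ti].
- by exists s => [|i lt_si]; [rewrite -eq_t | rewrite eq_s ?eq_t //; apply: ltn_trans lt_si].
- by exists s => [|i lt_si]; [rewrite -st in lt_t; lia | rewrite eq_s ?eq_t // -st].
Qed.

Lemma prefix_idealXP ms j w :
  prefix_ideal ms j ('X_[w] : {mpoly K[n]}) <-> exists2 m, m \in take j ms & (m <= w)%MM.
Proof. exact: mon_idealXP. Qed.

Lemma sorted_index_revlexlt ms m m' : sorted (@revlexlt n) ms ->
  m \in ms -> (index m' ms < index m ms)%N -> revlexlt m' m.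
Proof.
move=> ms_sorted m_ms lt_m'm.
have m'_ms : m' \in ms.
  by rewrite -index_mem; apply: ltn_trans lt_m'm _; rewrite index_mem.
have := sorted_ltn_nth revlexlt_trans 0%MM ms_sorted.
move=> /(_ (index m' ms) (index m ms)); rewrite !inE !index_mem !nth_index //.
by apply.
Qed.

(** [g w] is the first listed generator dividing w, and the list increases in the revlex order. *)
Lemma decomposition_least (J : {mpoly K[n]} -> Prop) ms g w :
  revlex_listing J ms -> decomposition_function J ms g -> monomials_of J w ->
  [/\ g w \in ms, (g w <= w)%MM &
    forall m, m \in ms -> (m <= w)%MM -> m = g w \/ revlexlt (g w) m].
Proof.
move=> [ms_gens ms_sorted] g_dec /g_dec[j [lt_j gE /prefix_idealXP[m m_take le_mw] j_min]].
have first m' : m' \in ms -> (m' <= w)%MM -> (j <= index m' ms)%N.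
  move=> m'_ms le_m'w; rewrite leqNgt; apply/negP => /j_min; apply.
  apply/prefix_idealXP; exists m' => //.
  by rewrite in_take.
have g_ms : g w \in ms by rewrite gE mem_nth.
have m_ms := mem_take m_take.
(* [m] is among the first j+1 generators and, by [first], not among the first j. *)
have jm : j = index m ms.
  by apply/eqP; rewrite eqn_leq first //= -ltnS index_ltn.
have gm : g w = m by rewrite gE jm nth_index.
split=> [//||m' m'_ms le_m'w]; first by rewrite gm.
have := first _ m'_ms le_m'w; rewrite leq_eqVlt => /orP[/eqP jE|lt_jm'].
  by left; rewrite gE jE nth_index.
by right; apply: (sorted_index_revlexlt ms_sorted m'_ms); rewrite gm -jm.
Qed.

Lemma lq_setP ms m s : sorted (@revlexlt n) ms -> m \in ms -> lq_set K ms m s ->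
  exists m', [/\ m' \in ms, (m' <= U_(s) + m)%MM & revlexlt m' m].
Proof.
rewrite /lq_set /colon -mpolyXD => ms_sorted m_ms /prefix_idealXP[m' m'_take le_m'].
exists m'; split=> //; first exact: mem_take m'_take.
exact: (sorted_index_revlexlt ms_sorted m_ms (index_ltn m'_take)).
Qed.

End Listing.

(** * The degree in x_0, ..., x_l *)

Section BarDegree.
Variables (n : nat) (l : 'I_n.+1).
Implicit Types (m w : 'X_{1..n.+1}).

(** The first key of [prec]. It is additive and positive on L(u, v), so it bounds the number of
    generators that m can be split into. *)
Definition bdeg m := mdeg (bar l m).

Lemma barE m (i : 'I_n.+1) : bar l m i = if (i <= l)%N then m i else 0%N.
Proof. exact: mnmE. Qed.

Lemma tildeE m (i : 'I_n.+1) : tilde l m i = if (l < i)%N then m i else 0%N.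
Proof. exact: mnmE. Qed.

Lemma bar_tilde m : (bar l m + tilde l m)%MM = m.
Proof.
by apply/mnmP => i; rewrite mnmDE barE tildeE; case: leqP; rewrite ?addn0.
Qed.

Lemma bdegD m w : bdeg (m + w)%MM = (bdeg m + bdeg w)%N.
Proof.
rewrite /bdeg -mdegD; congr mdeg; apply/mnmP => i.
by rewrite mnmDE !barE mnmDE; case: leqP.
Qed.

Lemma bdeg_eq0 m : (forall i : 'I_n.+1, (i <= l)%N -> m i = 0%N) -> bdeg m = 0%N.
Proof.
move=> m_l; apply/eqP; rewrite mdeg_eq0; apply/eqP/mnmP => i.
by rewrite barE mnm0E; case: leqP => // /m_l.
Qed.

Lemma bdegU (i : 'I_n.+1) : bdeg U_(i)%MM = (i <= l)%N.
Proof.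
have [le_il|lt_li] := leqP i l; last first.
  by apply: bdeg_eq0 => j le_jl; rewrite mnm1nE; lia.
rewrite -[RHS](mdeg1 i); congr mdeg; apply/mnmP => j.
by rewrite barE mnm1nE; case: leqP; lia.
Qed.

Lemma bdeg_gt0 m : (0 < bdeg m)%N -> exists i : 'I_n.+1, (i <= l)%N /\ m i != 0%N.
Proof.
move/mnm_supp => [i]; rewrite barE; case: leqP => // le_il mi.
by exists i.
Qed.

Lemma mnm_take m t : (t <= mdeg m)%N -> exists f, (f <= m)%MM /\ mdeg f = t.
Proof.
elim: t => [_|t IH lt_t].
  by exists 0%MM; rewrite mdeg0; split=> //; apply/mnm_lepP => i; rewrite mnm0E.
have [f [le_fm f_deg]] := IH (ltnW lt_t).
have [i] : exists i, (m - f)%MM i != 0%N.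
  by apply: mnm_supp; have := mdegD (m - f) f; rewrite submK //; lia.
rewrite mnmBE => lt_i; exists (f + U_(i))%MM; split.
  apply/mnm_lepP => j; rewrite mnmDE mnm1E; have := mnm_lepP le_fm j.
  by case: eqP => [<-|_]; lia.
by rewrite mdegD mdeg1 f_deg addn1.
Qed.

(* One variable x_i with i <= l and as many variables beyond l as possible. *)
Lemma split_factor d k m : (0 < d)%N -> mdeg m = (k.+1 * d)%N -> (k < bdeg m)%N ->
  exists2 f, (f <= m)%MM & [/\ mdeg f = d, (0 < bdeg f)%N & (k <= bdeg (m - f)%MM)%N].
Proof.
move=> d_pos m_deg lt_k.
have m_split : (bdeg m + mdeg (tilde l m))%N = mdeg m by rewrite -mdegD bar_tilde.
have tilde_bdeg f : (f <= tilde l m)%MM -> bdeg f = 0%N.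
  move=> le_f; apply: bdeg_eq0 => i le_il; apply/eqP; rewrite -leqn0.
  by apply: leq_trans (mnm_lepP le_f i) _; rewrite tildeE ltnNge le_il.
have sub_bdeg f : (f <= m)%MM -> (bdeg (m - f)%MM + bdeg f)%N = bdeg m.
  by move=> le_fm; rewrite -bdegD submK.
have [le_d|lt_d] := leqP d.-1 (mdeg (tilde l m)).
  have [f [le_f f_deg]] := mnm_take le_d.
  have [i [le_il mi]] : exists i : 'I_n.+1, (i <= l)%N /\ m i != 0%N.
    by apply: bdeg_gt0; apply: leq_ltn_trans lt_k.
  have le_fm : (U_(i) + f <= m)%MM.
    apply/mnm_lepP => j; rewrite mnmDE mnm1nE; have := mnm_lepP le_f j.
    rewrite tildeE; case: (ltnP l j); first by lia.
    have [<-|nij _] := eqVneq i j; first by lia.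
    by have : (i : nat) != j by []; lia.
  exists (U_(i) + f)%MM => //; split.
  - by rewrite mdegD mdeg1 f_deg; lia.
  - by rewrite bdegD bdegU le_il.
  - by have := sub_bdeg _ le_fm; rewrite bdegD bdegU le_il (tilde_bdeg _ le_f); lia.
(* With fewer than d-1 variables beyond l, f takes all of them, so m / f lies in x_0, ..., x_l and
   has bar-degree kd >= k. *)
have [f [le_f f_deg]] : exists f, (f <= bar l m)%MM /\ mdeg f = (d - mdeg (tilde l m))%N.
  by apply: mnm_take; rewrite -/(bdeg m); lia.
have le_fm : (f + tilde l m <= m)%MM.
  apply/mnm_lepP => j; rewrite mnmDE -[in X in (_ <= X)%N](bar_tilde m) mnmDE.
  by rewrite leq_add2r (mnm_lepP le_f).
have f_bar : bar l f = f.
  apply/mnmP => j; rewrite barE; case: leqP => // lt_lj.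
  by have := mnm_lepP le_f j; rewrite barE (leqNgt j l) lt_lj /=; lia.
have fd : bdeg (f + tilde l m)%MM = mdeg f.
  by rewrite bdegD (tilde_bdeg _ (lepm_refl _)) addn0 /bdeg f_bar.
exists (f + tilde l m)%MM => //; split; first by rewrite mdegD f_deg; lia.
  by rewrite fd f_deg; lia.
by have := sub_bdeg _ le_fm; rewrite fd f_deg; nia.
Qed.

End BarDegree.

(** * Generators of I and of its powers *)

Section Generators.
Variables (n d : nat) (l : 'I_n.+1) (u v : 'X_{1..n.+1}).
Implicit Types (m w a b : 'X_{1..n.+1}).
Hypotheses (d_gt1 : (1 < d)%N) (l_bd : (0 < l < n)%N) (u_deg : mdeg u = d).
Hypotheses (u0 : u ord0 = 1%N).
Hypothesis u_l : forall i : 'I_n.+1, (0 < i <= l)%N -> u i = 0%N.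
Hypothesis vE : v = (U_(l) + U_(ord_max) *+ (d - 1))%MM.
Local Notation T := (lexseg u v).

Let l_pos : (0 < l)%N. Proof. by case/andP: l_bd. Qed.
Let l_ltn : (l < n)%N. Proof. by case/andP: l_bd. Qed.

Let v_deg : mdeg v = d. Proof. by rewrite vE mdegD mdegMn !mdeg1; lia. Qed.
Let vEi i : v i = ((l == i :> nat) + (n == i :> nat) * (d - 1))%N.
Proof. by rewrite vE mnmDE mulmnE !mnm1nE. Qed.
Let v0 : v ord0 = 0%N. Proof. by rewrite vEi /=; lia. Qed.

Lemma lexseg_mdeg m : T m -> mdeg m = d.
Proof. by move/lexseg_deg->. Qed.

Definition tails w := (forall i : 'I_n.+1, (i <= l)%N -> w i = 0%N) /\ T (U_(ord0) + w)%MM.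

Lemma lexseg_bar m : mdeg m = d -> m ord0 = 0%N -> (0 < bdeg l m)%N -> T m.
Proof.
move=> m_deg m0 /bdeg_gt0[i [le_il mi]].
apply/and3P; split; first by rewrite m_deg u_deg.
  by rewrite vE; apply: (lexle_U_power (i := i)); rewrite // m_deg; lia.
by apply: lexlt_ord0; rewrite m0 u0.
Qed.

(** Since m <= u, x_0 occurs at most once in m, and if it does, m has no x_1, ..., x_l, as u has
    none. If it does not, some variable up to l must occur, since otherwise m < v at x_l. *)
Lemma lexseg_cases m : T m ->
  (m ord0 = 0%N /\ (0 < bdeg l m)%N) \/ (exists2 w, tails w & m = (U_(ord0) + w)%MM).
Proof.
move=> Tm; case/and3P: (Tm) => _ le_vm le_mu.
have := lexle_ord0 le_mu; rewrite u0 leq_eqVlt ltnS leqn0 => /orP[/eqP m0|/eqP m0].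
  right; have m0n : m ord0 != 0%N by rewrite m0.
  exists (m - U_(ord0))%MM; last by rewrite addmC subUK.
  split; last by rewrite addmC subUK.
  move=> i le_il; rewrite mnmBE mnm1nE; case: (posnP i) => [i0|i_pos].
    by have -> : i = ord0 by [apply: val_inj]; rewrite m0.
  by rewrite (lexle_prefix0 le_mu _ u_l) ?m0 ?u0 ?i_pos.
left; split=> //; rewrite lt0n; apply/negP => /eqP bm.
have m_l (i : 'I_n.+1) : (i <= l)%N -> m i = 0%N.
  move=> le_il; have := barE l m i; rewrite le_il => <-.
  by move/eqP: bm; rewrite mdeg_eq0 => /eqP->; rewrite mnm0E.
have : lexlt m v.
  apply/lexltP; exists l => [|i lt_il]; first by rewrite m_l // vEi eqxx.
  by rewrite m_l 1?ltnW // vEi; lia.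
have mv_deg : mdeg m = mdeg v by rewrite (lexseg_mdeg Tm) v_deg.
by rewrite lexltE // ltNge -lexleE ?le_vm.
Qed.

(** Passing to a variable of larger index lowers x_0 w, which keeps it at most u; the factor x_0
    keeps it above v. *)
Lemma tails_exchange w (t s : 'I_n.+1) : tails w -> w t != 0%N -> (t < s)%N ->
  tails (w - U_(t) + U_(s))%MM.
Proof.
move=> [w_l Tw] wt lt_ts.
have lt_lt : (l < t)%N by rewrite ltnNge; apply: contraNN wt => /w_l->.
split=> [i le_il|].
  by rewrite mnmDE mnmBE !mnm1nE w_l //; lia.
have w_deg : mdeg (w - U_(t) + U_(s))%MM = mdeg w.
  by rewrite mdegD mdeg1 -[in RHS](subUK wt) mdegD mdeg1.
case/and3P: Tw => Tw_deg le_v le_u; move: Tw_deg; rewrite mdegD mdeg1 => /eqP Tw_deg.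
apply/and3P; split; first by rewrite mdegD mdeg1 w_deg Tw_deg.
  by apply: lexlt_ord0; rewrite v0 mnmDE mnm1nE eqxx.
apply: (@lexle_trans _ (U_(ord0) + w)%MM) => //.
- by rewrite [LHS]mdegD [RHS]mdegD w_deg.
- by rewrite mdegD mdeg1.
rewrite lexle_add2l // -[in X in lexle _ X](subUK wt) lexle_add2l ?mdeg1 //.
exact/lexle_U/ltnW.
Qed.

Lemma products_tails_support k w (i : 'I_n.+1) :
  products tails k w -> (i <= l)%N -> w i = 0%N.
Proof.
move=> + le_il; elim: k w => [|k IH] w /= => [->|[a [b [[a_l _] /IH b_l ->]]]].
  by rewrite mnm0E.
by rewrite mnmDE a_l // b_l.
Qed.

Lemma products_tails_exchange k w (t s : 'I_n.+1) :
  products tails k w -> w t != 0%N -> (t < s)%N ->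
  products tails k (w - U_(t) + U_(s))%MM.
Proof.
move=> + + lt_ts; elim: k w => [|k IH] w /=.
  by move=> ->; rewrite mnm0E eqxx.
move=> [a [b [a_t b_t wE]]] wt.
have [at0|nat0] := eqVneq (a t) 0%N.
  have bt : b t != 0%N by move: wt; rewrite wE mnmDE at0.
  exists a, (b - U_(t) + U_(s))%MM; split=> //; first exact: IH.
  by apply: (@addIm _ U_(t)%MM); rewrite wE -{1}(subUK bt); apply/mnmP => i;
     rewrite !(mnmDE, mnmBE) mnm1nE; lia.
exists (a - U_(t) + U_(s))%MM, b; split=> //; first exact: tails_exchange.
by apply: (@addIm _ U_(t)%MM); rewrite wE -{1}(subUK nat0); apply/mnmP => i;
   rewrite !(mnmDE, mnmBE) mnm1nE; lia.
Qed.

(** Each factor adds at least 1 to the bar-degree, and those with x_0 supply the tails. Conversely,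
    factors are peeled off: x_0 a with a tail a while x_0 divides m, which costs bar-degree 1, and
    then those given by [split_factor]. *)
Lemma products_lexsegP k m :
  products T k m <->
  [/\ mdeg m = (k * d)%N, (k <= bdeg l m)%N
    & exists2 w, products tails (m ord0) w & (w <= m)%MM].
Proof.
split.
  elim: k m => [|k IH] m /=.
    move=> ->; rewrite mdeg0 mnm0E; split=> //.
    by exists 0%MM => //; apply: lepm_refl.
  move=> [a [b [Ta /IH[b_deg b_bd [w w_t le_wb]] ->]]].
  rewrite mdegD (lexseg_mdeg Ta) b_deg bdegD mnmDE; split; first by rewrite mulSn.
    case: (lexseg_cases Ta) => [[_ a_bd]|[w' _ ->]]; first by rewrite -addn1 addnC leq_add.
    by rewrite bdegD bdegU /=; lia.
  case: (lexseg_cases Ta) => [[a0 _]|[w' [w'_l Tw'] aE]].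
    by rewrite a0; exists w => //; apply: lepm_trans le_wb (lem_addl _ _).
  rewrite aE mnmDE mnm1E eqxx w'_l //; exists (w' + w)%MM; first by exists w', w.
  by apply/mnm_lepP => i; rewrite !mnmDE; have := mnm_lepP le_wb i; lia.
elim: k m => [|k IH] m [m_deg m_bd [w w_t le_wm]] /=.
  by apply/eqP; rewrite -mdeg_eq0 m_deg.
have [m0|m0n] := eqVneq (m ord0) 0%N.
  have [|f le_fm [f_deg f_bd mf_bd]] := split_factor (l := l) _ m_deg m_bd; first by lia.
  have f0 : f ord0 = 0%N by have := mnm_lepP le_fm ord0; rewrite m0; lia.
  exists f, (m - f)%MM; split; last by rewrite addmC submK.
    exact: lexseg_bar.
  apply: IH; split=> //; first by have := mdegD (m - f) f; rewrite submK // f_deg m_deg mulSn; lia.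
  by rewrite mnmBE m0; exists 0%MM => //; apply/mnm_lepP => i; rewrite mnm0E.
case m0: (m ord0) m0n w_t => [|j] // _ /=.
move=> [a [b [a_t b_t wE]]]; have [a_l Ta] := a_t.
have le_am : (U_(ord0) + a <= m)%MM.
  apply/mnm_lepP => i; have := mnm_lepP le_wm i; rewrite wE !mnmDE mnm1nE.
  case: (posnP i) => [i0|i_pos]; last by rewrite [X in (X == _)%N]/=; lia.
  by have -> : i = ord0 by [apply: val_inj]; rewrite a_l // m0 /=; lia.
exists (U_(ord0) + a)%MM, (m - (U_(ord0) + a))%MM; split=> //; last by rewrite addmC submK.
have Ta_deg := lexseg_mdeg Ta.
apply: IH; split.
- by have := mdegD (m - (U_(ord0) + a)) (U_(ord0) + a); rewrite submK // Ta_deg m_deg mulSn; lia.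
- have := bdegD l (m - (U_(ord0) + a)) (U_(ord0) + a); rewrite submK // bdegD bdegU.
  by rewrite (bdeg_eq0 a_l) /=; lia.
rewrite mnmBE mnmDE mnm1E eqxx a_l // m0 /=.
exists b; first by rewrite addn0 subn1.
apply/mnm_lepP => i; rewrite mnmBE mnmDE mnm1nE.
have := mnm_lepP le_wm i; rewrite wE mnmDE.
case: (posnP i) => [i0|i_pos]; last by rewrite [X in (X == _)%N]/=; lia.
have -> : i = ord0 by [apply: val_inj].
by rewrite (products_tails_support b_t).
Qed.

End Generators.

(** * The decomposition function of the powers of I *)

Section Decomposition.
Variables (n : nat) (K : fieldType).
Implicit Types (m w : 'X_{1..n.+1}).

Lemma lem_mdegS m w : (m <= w)%MM -> mdeg w = (mdeg m).+1 ->
  exists2 i, w i != 0%N & m = (w - U_(i))%MM.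
Proof.
move=> le_mw w_deg; have sub_deg := mdegD (w - m) m.
rewrite submK // w_deg -add1n in sub_deg.
have /mdeg1P[i /eqP wmi] : mdeg (w - m)%MM == 1%N by move: sub_deg; lia.
have wE : w = (U_(i) + m)%MM by rewrite -wmi submK.
exists i; first by rewrite wE mnmDE mnm1E eqxx.
by rewrite wE addmC addmK.
Qed.

(* The quotients w / x_i increase in the revlex order with i. *)
Lemma decomposition_min (J : {mpoly K[n.+1]} -> Prop) ms g w e (t : 'I_n.+1) :
  revlex_listing J ms -> decomposition_function J ms g -> monomials_of J w ->
  (forall m, min_gens J m -> mdeg m = e) -> mdeg w = e.+1 ->
  w t != 0%N -> min_gens J (w - U_(t))%MM ->
  (forall i : 'I_n.+1, (i < t)%N -> w i != 0%N -> ~ min_gens J (w - U_(i))%MM) ->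
  g w = (w - U_(t))%MM.
Proof.
move=> ms_list g_dec Jw J_deg w_deg wt Jt t_min.
have [g_ms le_gw g_least] := decomposition_least ms_list g_dec Jw.
have [ms_gens _] := ms_list; have Jg := (ms_gens _).1 g_ms.
have [|i wi gE] := lem_mdegS le_gw; first by rewrite w_deg (J_deg _ Jg).
have le_ti : (t <= i)%N.
  by rewrite leqNgt; apply/negP => /t_min/(_ wi); rewrite -gE.
have le_tw : (w - U_(t) <= w)%MM by apply: lem_subr.
case: (g_least _ ((ms_gens _).2 Jt) le_tw) => [->//|/revlexltP[r]].
have [it|nit] := eqVneq i t; first by rewrite gE it ltnn.
have lt_ti : (t < i)%N by rewrite ltn_neqAle le_ti eq_sym nit.
rewrite gE !mnmBE !mnm1nE => lt_r eq_r.
have rt : (r : nat) = t by move: lt_r; lia.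
have := eq_r i; rewrite rt !mnmBE !mnm1nE eqxx => /(_ lt_ti).
by move: wi; lia.
Qed.

Section Powers.
Variables (d : nat) (l : 'I_n.+1) (u v : 'X_{1..n.+1}).
Hypotheses (d_gt1 : (1 < d)%N) (l_bd : (0 < l < n)%N) (u_deg : mdeg u = d).
Hypotheses (u0 : u ord0 = 1%N).
Hypothesis u_l : forall i : 'I_n.+1, (0 < i <= l)%N -> u i = 0%N.
Hypothesis vE : v = (U_(l) + U_(ord_max) *+ (d - 1))%MM.

Let l_pos : (0 < l)%N. Proof. by case/andP: l_bd. Qed.
Let l_ltn : (l < n)%N. Proof. by case/andP: l_bd. Qed.

Let vkE k i : (v *+ k)%MM i = (((l == i :> nat) + (n == i :> nat) * (d - 1)) * k)%N.
Proof. by rewrite mulmnE vE mnmDE mulmnE !mnm1nE. Qed.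

Let v_deg : mdeg v = d. Proof. by rewrite vE mdegD mdegMn !mdeg1; lia. Qed.

Lemma bdeg_vk k : bdeg l (v *+ k)%MM = k.
Proof.
rewrite -[RHS]mul1n -(mdeg1 l) -mdegMn; congr mdeg; apply/mnmP => i.
rewrite barE vkE mulmnE mnm1nE; have := ltn_ord i; case: (leqP i l) => ?; nia.
Qed.

(* The bar-degree decides the comparison, as v^k is the least monomial of
   bar-degree k. *)
Lemma succeq_bdeg k x : succeq l x (v *+ k)%MM -> (k <= bdeg l x)%N.
Proof.
rewrite /succeq /prec -!/(bdeg l _) bdeg_vk.
by case/orP => [/orP[/ltnW//|/andP[/eqP<-]]|/eqP->]; rewrite ?bdeg_vk.
Qed.

Lemma prec_bdeg k x : mdeg x = (k * d)%N -> prec l x (v *+ k)%MM -> (bdeg l x < k)%N.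
Proof.
move=> x_deg; rewrite /prec -!/(bdeg l _) bdeg_vk => /orP[//|/andP[/eqP x_bd]].
case/lexltP => r lt_r eq_r; exfalso.
(* As v^k involves only x_l and x_n, the first difference is at one of them. At l, the bar part of x
   is a power of x_l with exponent below k; at n, x divides v^k and has its degree. *)
have [rl|nrl] := eqVneq (r : nat) l.
  have rE : r = l by apply: val_inj.
  have xE : bar l x = (U_(l) *+ x l)%MM.
    apply/mnmP => i; rewrite barE mulmnE mnm1nE.
    case: (ltngtP i l) => [lt_il|lt_li|/val_inj->]; rewrite /=; last by lia.
      by rewrite eq_r ?rl // vkE; lia.
    by lia.
  move: x_bd lt_r; rewrite /bdeg xE mdegMn mdeg1 rE vkE eqxx.
  by lia.
have rn : (r : nat) = n by move: lt_r nrl; rewrite vkE; nia.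
have le_xv : (x <= v *+ k)%MM.
  apply/mnm_lepP => i; have [/eq_r->//|le_ri] := ltnP i r.
  have -> : i = r by apply: val_inj => /=; have := ltn_ord i; lia.
  exact: ltnW.
by move: lt_r; rewrite (lem_mdeg_eq le_xv) ?ltnn // mdegMn v_deg x_deg mulnC.
Qed.

Let J k := ideal_exp (mon_ideal (lexseg u v) : {mpoly K[n.+1]} -> Prop) k.

Let T_deg m : lexseg u v m -> mdeg m = d.
Proof. by move/lexseg_deg->. Qed.

Lemma min_gens_powerP k m : min_gens (J k) m <->
  [/\ mdeg m = (k * d)%N, (k <= bdeg l m)%N
    & exists2 w, products (tails l u v) (m ord0) w & (w <= m)%MM].
Proof.
have := min_gens_expP K k m T_deg.
have := products_lexsegP d_gt1 l_bd u_deg u0 u_l vE k m.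
by move=> P Q; split=> [/Q/P|/P/Q].
Qed.

(** By [decomposition_min] it suffices to find the smallest i for which x_s m / x_i is a generator.
    This is min(m) if the bar-degree stays at least k; otherwise only variables beyond l may be
    removed. *)
Lemma decomposition_power k ms g m (s : 'I_n.+1) :
  (0 < k)%N -> revlex_listing (J k) ms -> decomposition_function (J k) ms g ->
  min_gens (J k) m -> lq_set K ms m s ->
  (succeq l (U_(s) + m - U_(mmin m))%MM (v *+ k)%MM ->
     g (U_(s) + m)%MM = (U_(s) + m - U_(mmin m))%MM) /\
  (prec l (U_(s) + m - U_(mmin m))%MM (v *+ k)%MM ->
     g (U_(s) + m)%MM = (U_(s) + m - U_(mmin (tilde l m)))%MM).
Proof.
move=> k_pos ms_list g_dec Jm s_set.
have [ms_gens ms_sorted] := ms_list.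
have J_deg m' : min_gens (J k) m' -> mdeg m' = (k * d)%N.
  by case/min_gens_powerP.
have [m_deg m_bd [b b_t le_bm]] := (min_gens_powerP k m).1 Jm.
set w := (U_(s) + m)%MM.
have wE i : w i = ((s == i :> nat) + m i)%N by rewrite mnmDE mnm1nE.
have w_deg : mdeg w = (k * d).+1 by rewrite mdegD mdeg1 m_deg.
have w_bd : bdeg l w = ((s <= l) + bdeg l m)%N by rewrite bdegD bdegU.
have Jw : monomials_of (J k) w.
  apply/ideal_expXP; exists m; last exact: lem_addl.
  exact/(min_gens_expP K k m T_deg).
have sub_deg (i : 'I_n.+1) : w i != 0%N -> mdeg (w - U_(i))%MM = (k * d)%N.
  by move=> wi; rewrite mdeg_subU // w_deg.
have sub_bd (i : 'I_n.+1) : w i != 0%N -> (bdeg l (w - U_(i))%MM + (i <= l))%N = bdeg l w.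
  by move=> wi; rewrite -bdegU -bdegD subUK.
have [m' [m'_ms le_m'w lt_m'm]] := lq_setP ms_sorted ((ms_gens m).2 Jm) s_set.
have Jm' := (ms_gens _).1 m'_ms.
have [|i wi m'E] := lem_mdegS le_m'w; first by rewrite w_deg (J_deg _ Jm').
(* m' = x_s m / x_i is revlex-smaller than m, so the last variable where they differ is x_s. In
   particular min(m) <= i < s. *)
have lt_is : (i < s)%N.
  case/revlexltP: lt_m'm => r; rewrite m'E !mnmBE wE mnm1nE => lt_r eq_r.
  have rs : (r : nat) = s by move: lt_r; lia.
  rewrite ltnNge leq_eqVlt; apply/negP => /orP[/eqP si|lt_si].
    by move: lt_r; lia.
  have := eq_r i; rewrite rs mnmBE mnm1nE eqxx => /(_ lt_si).
  by move: wi; rewrite wE; lia.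
have mi : m i != 0%N by move: wi; rewrite wE; lia.
have [mt le_ti] := mmin_first mi; set t := mmin m in mt le_ti *.
have m_pos : (0 < mdeg m)%N by rewrite m_deg; nia.
have [_ m_lt] := mminP m_pos; rewrite -/t in m_lt.
have lt_ts : (t < s)%N by apply: leq_ltn_trans lt_is.
have wt : w t != 0%N by rewrite wE; lia.
have s_pos : (0 < s)%N by apply: leq_ltn_trans lt_ts.
split=> [/succeq_bdeg x_bd|/prec_bdeg-/(_ (sub_deg _ wt)) x_bd].
  apply: (decomposition_min ms_list g_dec Jw J_deg w_deg wt); last first.
    by move=> r lt_rt; rewrite wE m_lt //; lia.
  apply/min_gens_powerP; split=> //; first exact: sub_deg.
  (* Removing x_0 lowers the number of tails required by one, so one factor of b is dropped. If t >
     0, x_0 does not occur and the empty product suffices. *)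
  case: (posnP t) => [t0|t_pos].
    have tE : t = ord0 by apply: val_inj.
    move: b_t mt; rewrite mnmBE wE mnm1nE tE /=.
    case m0: (m ord0) => [|j] //= [a [b' [_ b'_t bE]]] _.
    exists b'; first by have -> : ((s == 0 :> nat) + j.+1 - 1)%N = j by lia.
    apply/mnm_lepP => r; rewrite mnmBE wE mnm1nE /=; have := mnm_lepP le_bm r.
    rewrite bE mnmDE; case: (posnP r) => [r0|r_pos]; last by lia.
    have -> : r = ord0 by apply: val_inj.
    by rewrite (products_tails_support b'_t) //; lia.
  have m0 : m ord0 = 0%N by apply: m_lt.
  exists 0%MM; last by apply/mnm_lepP => r; rewrite mnm0E.
  by rewrite mnmBE wE mnm1nE m0 /=; have -> : (s == 0 :> nat) = false by lia.
(* m has bar-degree at least k, and x_s m / x_t has less: this forces s > l and bar-degree exactly k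
   for m. *)
have := sub_bd _ wt; rewrite w_bd => wt_bd.
have lt_ls : (l < s)%N by move: wt_bd; case: (leqP s l); lia.
have m_bdk : bdeg l m = k by move: wt_bd; lia.
have [_ m'_bd _] := (min_gens_powerP k m').1 Jm'.
(* The generator m' = x_s m / x_i has bar-degree at least k, so i > l; thus [tilde l m] is not 1 and
   its least variable q satisfies q <= i < s. *)
have lt_li : (l < i)%N.
  by rewrite ltnNge; apply/negP => le_il; have := sub_bd _ wi; rewrite -m'E w_bd le_il; lia.
have tmi : tilde l m i != 0%N by rewrite tildeE lt_li.
have [tmq le_qi] := mmin_first tmi; set q := mmin (tilde l m) in tmq le_qi *.
have tm_pos : (0 < mdeg (tilde l m))%N.
  by rewrite lt0n mdeg_eq0; apply: contraNneq tmi => ->; rewrite mnm0E.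
have [_ q_lt] := mminP tm_pos; rewrite -/q in q_lt.
have lt_lq : (l < q)%N by move: tmq; rewrite tildeE; case: ltnP.
have mq : m q != 0%N by move: tmq; rewrite tildeE lt_lq.
have lt_qs : (q < s)%N by apply: leq_ltn_trans lt_is.
have wq : w q != 0%N by rewrite wE; lia.
apply: (decomposition_min ms_list g_dec Jw J_deg w_deg wq); last first.
  (* Removing x_r with r <= l leaves bar-degree k-1, and no x_r with l < r < q divides x_s m. *)
  move=> r lt_rq wr /min_gens_powerP[_ r_bd _].
  have [le_rl|lt_lr] := leqP r l.
    by have := sub_bd _ wr; rewrite w_bd le_rl; lia.
  have := q_lt _ lt_rq; rewrite tildeE lt_lr => mr.
  by move: wr; rewrite wE mr; lia.
apply/min_gens_powerP; split; first exact: sub_deg.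
  by have := sub_bd _ wq; rewrite w_bd m_bdk; lia.
have -> : (w - U_(q))%MM ord0 = m ord0 by rewrite mnmBE wE mnm1nE /=; lia.
(* If m has more x_q than the tail product b, then b still divides x_s m / x_q. Otherwise one x_q in
   b is exchanged for x_s, which q < s permits. *)
have [lt_bq|ge_bq] := ltnP (b q) (m q).
  exists b => //; apply/mnm_lepP => r; rewrite mnmBE wE mnm1nE.
  have := mnm_lepP le_bm r; have [<-|nqr] := eqVneq q r; first by lia.
  by have : (q : nat) != r by []; lia.
have bq : b q != 0%N by move: mq ge_bq; lia.
exists (b - U_(q) + U_(s))%MM.
  exact: (products_tails_exchange d_gt1 l_bd u_deg u0 vE b_t bq lt_qs).
apply/mnm_lepP => r; rewrite mnmDE !mnmBE wE !mnm1nE.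
by have := mnm_lepP le_bm r; have [<-|nqr] := eqVneq q r; lia.
Qed.

End Powers.
End Decomposition.

Theorem corollary2p8 (K : fieldType) (n d : nat) (u v : 'X_{1..n.+1}) :
  (2 <= d)%N -> mdeg u = d -> mdeg v = d -> lexlt v u ->
  u ord0 <> 0%N -> v ord0 = 0%N ->
  let I : {mpoly K[n.+1]} -> Prop := mon_ideal (lexseg u v) in
  linear_resolution I ->
  ~ completely_lexseg_ideal I ->
  exists l : 'I_n.+1,
    [/\ (0 < l < n)%N,
        exists a : 'I_n.+1 -> nat,
          u = (U_(ord0) + \sum_(i < n.+1 | (l < i)%N) U_(i) *+ a i)%MM,
        v = (U_(l) + U_(ord_max) *+ (d - 1))%MM
      & forall (k : nat) (ms : seq 'X_{1..n.+1}) (g : 'X_{1..n.+1} -> 'X_{1..n.+1}),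
          (1 <= k)%N ->
          revlex_listing (ideal_exp I k) ms ->
          decomposition_function (ideal_exp I k) ms g ->
          forall (m : 'X_{1..n.+1}) (s : 'I_n.+1),
            min_gens (ideal_exp I k) m -> lq_set K ms m s ->
            (succeq l (U_(s) + m - U_(mmin m))%MM (v *+ k)%MM ->
               g (U_(s) + m)%MM = (U_(s) + m - U_(mmin m))%MM)
            /\
            (prec l (U_(s) + m - U_(mmin m))%MM (v *+ k)%MM ->
               g (U_(s) + m)%MM = (U_(s) + m - U_(mmin (tilde l m)))%MM)].
Proof.
move=> d_gt1 u_deg v_deg lt_vu u0n v0 I lin not_complete.
have u_pos : (0 < u ord0)%N by rewrite lt0n; apply/eqP.
have [|l [l_bd u0 u_l vE]] := lexseg_shape d_gt1 u_deg v_deg u_pos v0 lin.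
  by move=> complete; apply: not_complete; exists (lexseg u v).
exists l; split=> // [|k ms g k_pos ms_list g_dec m s Jm s_set]; last first.
  exact: (decomposition_power d_gt1 l_bd u_deg u0 u_l vE k_pos ms_list g_dec Jm s_set).
(* The exponents a_i are those of u itself, which has x_0 once and no x_1, ..., x_l. *)
exists u; apply/mnmP => i; rewrite mnmDE mnm_sumE mnm1E.
under eq_bigr => j _ do rewrite mulmnE mnm1E.
rewrite big_mkcond (bigD1 i) //= big1 => [|j /negPf->]; last by rewrite mul0n if_same.
rewrite eqxx mul1n addn0; case: (eqVneq ord0 i) => [<-|]; first by rewrite u0.
rewrite eq_sym => /ord_neq0 i_pos; case: ltnP => //= le_il.
by rewrite u_l ?i_pos.
Qed.
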